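(* Let $n\ge3$ and $r\ge1$ be integers. Every nonzero eigenvalue of $K_{n,r}$ is real, positive, and simple (i.e. of algebraic multiplicity one).
   Context: For integers $n\ge3$ and $r\ge1$, the digraph $\Gamma_{n,r}$ has vertex set $V(\Gamma_{n,r})=\{1,2,\dots,rn-2r+2\}$ and directed edge set $E(\Gamma_{n,r})$ defined by $E(\Gamma_{n,1})=\{(j,j+1):1\le j\le n-1\}\cup\{(n,1)\}$; $E(\Gamma_{n,2})=E(\Gamma_{n,1})\cup\{(1,n+1)\}\cup\{(j,j+1):n+1\le j\le 2n-3\}\cup\{(2n-2,n)\}$; and for $r\ge3$, $E(\Gamma_{n,r})=E(\Gamma_{n,2})\cup\bigcup_{i=1}^{r-2}F_i$, where $F_i=\{(in-2i+2,\,in+n-2i+1)\}\cup\{(j,j+1):in+n-2i+1\le j\le in+2n-2i-3\}\cup\{(in+2n-2i-2,\,in+n-2i)\}$. (For $n=3$ the middle path parts are empty.) Layers: define $\ell:V(\Gamma_{n,r})\to\mathbb Z/n\mathbb Z$ along this recursive construction (edges being added in the order in which they are listed above) by $\ell(1)=0$ and, whenever a vertex $v\ne1$ appears for the first time as the terminal vertex of a newly added edge $(u,v)$, $\ell(v)\equiv\ell(u)+1 \pmod n$. For $c\in\mathbb Z/n\mathbb Z$ set $V^{(c)}_{n,r}=\{v:\ell(v)\equiv c \pmod n\}$. Every edge goes from some $V^{(c)}_{n,r}$ to $V^{(c+1)}_{n,r}$ (indices mod $n$). Let $B_{n,r}^{(c)}$ be the $(0,1)$-matrix with rows indexed by $V^{(c)}_{n,r}$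 and columns by $V^{(c+1)}_{n,r}$ (each in increasing order, indices mod $n$), with $(u,v)$-entry $1$ if and only if $(u,v)\in E(\Gamma_{n,r})$. The cyclic product core is the square matrix $K_{n,r}=B_{n,r}^{(0)}B_{n,r}^{(1)}\cdots B_{n,r}^{(n-1)}$, indexed by $V^{(0)}_{n,r}$. *)

(* Defs.v *)
From HB Require Import structures.
From mathcomp Require Import all_boot all_order all_algebra.
From mathcomp Require Import complex reals.

Set Implicit Arguments.
Unset Strict Implicit.
Unset Printing Implicit Defensive.

Import Order.TTheory GRing.Theory Num.Theory.

(** Vertices are the natural numbers [1 .. r * n - 2 * r + 2]; edge sets are
    sequences, because the layer function depends on the order in which the
    edges are added. No subtraction below is truncated when [3 <= n] and
    [1 <= r]; this fails for the term [r - 2] only if [r = 1], where it is not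
    used. *)

Definition vertices (n r : nat) : seq nat := iota 1 (r * n - 2 * r + 2).

(** The edges [(j, j + 1)] for [a <= j <= b] (none if [b < a]). *)
Definition arcs (a b : nat) : seq (nat * nat) :=
  [seq (j, j.+1) | j <- index_iota a b.+1].

Definition edges1 (n : nat) : seq (nat * nat) :=
  arcs 1 (n - 1) ++ [:: (n, 1)].

Definition edges2 (n : nat) : seq (nat * nat) :=
  edges1 n ++ (1, n + 1) :: arcs (n + 1) (2 * n - 3) ++ [:: (2 * n - 2, n)].

Definition edgesF (n i : nat) : seq (nat * nat) :=
  (i * n - 2 * i + 2, i * n + n - 2 * i + 1)
    :: arcs (i * n + n - 2 * i + 1) (i * n + 2 * n - 2 * i - 3)
    ++ [:: (i * n + 2 * n - 2 * i - 2, i * n + n - 2 * i)].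

(** Meaningful for [1 <= r] only. *)
Definition edges (n r : nat) : seq (nat * nat) :=
  if r == 1 then edges1 n
  else edges2 n ++ flatten [seq edgesF n i | i <- index_iota 1 (r - 2).+1].

(** Elements of Z/nZ are represented by their residues in [0 .. n - 1]; [None]
    stands for a vertex that has not appeared yet. *)
Definition add_edge (n : nat) (l : nat -> option nat) (e : nat * nat) :
    nat -> option nat :=
  if l e.2 is Some _ then l
  else [eta l with e.2 |-> omap (fun c => c.+1 %% n) (l e.1)].

Definition layer (n r : nat) : nat -> option nat :=
  foldl (add_edge n) [fun _ : nat => None with 1 |-> Some 0] (edges n r).

(** [V^(c)], in increasing order; [c] is read modulo [n]. *)
Definition layer_class (n r c : nat) : seq nat :=
  [seq v <- vertices n r | layer n r v == Some (c %% n)].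

Lemma size_layer_class_modn (n r : nat) :
  size (layer_class n r n) = size (layer_class n r 0).
Proof. by rewrite /layer_class modnn mod0n. Qed.

Section Core.
Local Open Scope ring_scope.

Definition layer_mx (F : fieldType) (n r c : nat) :
    'M[F]_(size (layer_class n r c), size (layer_class n r c.+1)) :=
  \matrix_(i, j)
    ((nth 0%N (layer_class n r c) i, nth 0%N (layer_class n r c.+1) j)
       \in edges n r)%:R.

(** The product [B^(0) B^(1) ... B^(k - 1)]. *)
Fixpoint layer_prod (F : fieldType) (n r k : nat) :
    'M[F]_(size (layer_class n r 0), size (layer_class n r k)) :=
  if k is k'.+1 then layer_prod F n r k' *m layer_mx F n r k' else 1%:M.

(** The cast identifies [V^(n)] with [V^(0)]. *)
Definition cyclic_core (F : fieldType) (n r : nat) :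
    'M[F]_(size (layer_class n r 0)) :=
  castmx (erefl, size_layer_class_modn n r) (layer_prod F n r n).

End Core.

(* Main.v *)
Require Import Defs.
From mathcomp Require Import all_boot all_order all_algebra.
From mathcomp Require Import complex reals.
From mathcomp Require Import fingroup perm.
From mathcomp Require Import zify ring.

Set Implicit Arguments.
Unset Strict Implicit.
Unset Printing Implicit Defensive.

Import Order.TTheory GRing.Theory Num.Theory.
Local Open Scope ring_scope.

(** Write n = m + 2 and let A be the adjacency matrix of the digraph, whose
    vertices are numbered from 0 here. All vertices have a single outgoing arc,
    except among a_0 = 0 and a_i = i * m + 1 (1 <= i <= r), and the simple
    cycles are the r cycles of length n from which the digraph is built. Two of
    them meet exactly when their indices differ by at most 2, so that counting
    families of disjoint cycles suggests
    det (1 - t A) = c_(r+2) (t ^ n), with c_0 = c_1 = c_2 = 1 and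
    c_(j+3) (s) = c_(j+2) (s) - s c_j (s).

    The determinant is computed by cutting walks at a set S of vertices that
    meets every cycle. The first-return matrix of S, weighted by length, has
    the same determinant det (1 - _) as t A ([det_first_return]). For
    S = layer 0 all first returns have length n and the matrix is t ^ n K
    ([det_layers]); for S = {a_0, ..., a_r} it is banded, with determinant
    given by the recurrence above ([det_branches]). Comparing the two, the
    nonzero roots of the characteristic polynomial of K are, with
    multiplicities, those of the reciprocal polynomial of c_(r+2)
    ([char_poly_cyclic_core]).

    It remains to see that the roots of c_j are real, positive and simple.
    When Im s < 0, the ratios a = c_(j+1) / c_(j+2) and b = c_j / c_(j+1) and
    the products a b, s a, s b, s a b all stay in the closed lower half-plane:
    the recurrence replaces (a, b) by (1 / (1 - s a b), a), and each of the new
    products is the inverse of a difference between an upper and a lower number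
    ([ratio_step]). Hence c_j has no nonreal zero, and on the negative axis it
    is visibly positive. Moreover c_j / c_(j+3), c_(j+1) / c_(j+3) and
    c_(j+2) / c_(j+3) map the lower half-plane to its closure, which forbids a
    multiple pole on the real line ([mup_le1_of_half_plane]); since three
    consecutive c_j cannot vanish together, every zero is simple. *)

(** * Determinants *)

(** Sylvester's identity: the two sides are the determinants of the products,
    in either order, of the same two block-triangular factors. *)
Lemma det_1D_mulC (R : comPzRingType) m n
    (A : 'M[R]_(m, n)) (B : 'M[R]_(n, m)) :
  \det (1%:M + A *m B) = \det (1%:M + B *m A).
Proof.
have E1 : block_mx (1%:M + A *m B) A 0 1%:M
    = block_mx 1%:M A (- B) 1%:M *m block_mx 1%:M 0 B 1%:M.
  by rewrite mulmx_block !mulmx0 !mulmx1 !mul1mx !add0r addNr.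
have E2 : block_mx 1%:M A 0 (1%:M + B *m A)
    = block_mx 1%:M 0 B 1%:M *m block_mx 1%:M A (- B) 1%:M.
  by rewrite mulmx_block !mul0mx !mulmx1 !mul1mx !addr0 subrr addrC.
have := congr1 determinant E1; rewrite det_mulmx mulrC -det_mulmx -E2.
by rewrite !det_ublock !det1 mul1r mulr1.
Qed.

(** Along a permutation with a nonzero contribution to the Leibniz formula [h]
    never decreases; as its sum is preserved, the permutation is trivial. *)
Lemma det_graded (R : comPzRingType) p (h : 'I_p -> nat) (Z : 'M[R]_p) :
  (forall u v, u != v -> Z u v != 0 -> (h u < h v)%N) ->
  \det Z = \prod_u Z u u.
Proof.
move=> hZ; rewrite /determinant (bigD1 (1%g : {perm _})) //= [X in _ + X]big1
  => [|s s1].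
  by rewrite addr0 odd_perm1 expr0 mul1r; apply: eq_bigr => u _; rewrite perm1.
have [/existsP[u /eqP Zu0]|] := boolP [exists u, Z u (s u) == 0].
  by rewrite (bigD1 u) //= Zu0 mul0r mulr0.
rewrite negb_exists => /forallP Zn0; case/eqP: s1.
have le_h u : (h u <= h (s u))%N.
  by have [<-|/hZ/(_ (Zn0 u))/ltnW] := eqVneq u (s u).
have eq_h : (\sum_u h u = \sum_u h (s u))%N.
  by rewrite (reindex_inj (@perm_inj _ s)).
apply/permP=> u; rewrite perm1; apply/eqP; rewrite eq_sym; apply/negPn/negP.
move=> /hZ/(_ (Zn0 u)) lt_h.
have : (\sum_u h u < \sum_u h (s u))%N.
  rewrite (bigD1 u) //= [X in (_ < X)%N](bigD1 u) //= -addSn.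
  by apply: leq_add => //; apply: leq_sum.
by rewrite -eq_h ltnn.
Qed.

(** Both [M (1 + (Y - E') E)] and
    [(M (1 - E' E) + E' E) (1 + E' (C - 1) E)] are equal to
    [M (1 - E' E) + E' C E], and Sylvester's identity evaluates the two factors
    that perturb 1. The role of [E] and [E'] is to restrict to a subset of the
    indices and to extend by 0 from it. *)
Lemma det_reduction (R : comPzRingType) p k (M : 'M[R]_p) (C : 'M[R]_k)
    (E : 'M[R]_(k, p)) (E' Y : 'M[R]_(p, k)) :
    E *m E' = 1%:M -> E *m Y = 1%:M -> M *m Y = E' *m C ->
  \det M = \det (M *m (1%:M - E' *m E) + E' *m E) * \det C.
Proof.
move=> EE' EY MY.
have detY : \det (1%:M + (Y - E') *m E) = 1.
  by rewrite det_1D_mulC mulmxBr EE' EY subrr addr0 det1.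
have detC : \det (1%:M + E' *m ((C - 1%:M) *m E)) = \det C.
  by rewrite det_1D_mulC -mulmxA EE' mulmx1 addrC subrK.
rewrite -[LHS]mulr1 -[in LHS]detY -detC -!det_mulmx; congr (\det _).
set Q := 1%:M - E' *m E.
have absorb : (M *m Q + E' *m E) *m E' = E'.
  by rewrite mulmxDl -!mulmxA mulmxBl mul1mx -mulmxA EE' mulmx1 subrr mulmx0
    add0r.
have MQ : M *m Q = M - M *m E' *m E by rewrite mulmxBr mulmx1 mulmxA.
clearbody Q; transitivity (M *m Q + E' *m C *m E).
  rewrite mulmxDr mulmx1 mulmxBl mulmxBr !mulmxA MY MQ.
  by rewrite addrA addrAC.
rewrite [RHS]mulmxDr mulmx1 (mulmxA _ E') absorb mulmxBl mul1mx mulmxBr mulmxA.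
by rewrite -addrA [_ *m E + _]addrC subrK.
Qed.

(** Cramer's rule for a right-hand side supported at the first index. *)
Lemma det_cofactor_of_col (F : fieldType) p (C : 'M[F]_p.+1) (v : 'cV[F]_p.+1)
    (q : F) : C *m v = q *: delta_mx 0 0 ->
  \det C * v ord_max 0 = q * cofactor C 0 ord_max.
Proof.
move=> Cv; have := congr1 (fun w => (\adj C *m w) ord_max 0) Cv.
rewrite mulmxA mul_adj_mx mul_scalar_mx -scalemxAr !mxE => ->; congr (_ * _).
rewrite (bigD1 0) //= big1 => [|j /negPf j0];
  rewrite !mxE ?eqxx ?mulr1 ?addr0 //.
by rewrite j0 mulr0.
Qed.

Section Selection.
Variables (R : comPzRingType) (k p : nat).

Definition select_mx (f : 'I_k -> 'I_p) : 'M[R]_(k, p) :=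
  \matrix_(i, u) (u == f i)%:R.

Variable f : 'I_k -> 'I_p.

Lemma mul_select_mx q (X : 'M[R]_(p, q)) i j :
  (select_mx f *m X) i j = X (f i) j.
Proof.
rewrite !mxE (bigD1 (f i)) //= !mxE eqxx mul1r big1 ?addr0 // => u /negPf ui.
by rewrite !mxE ui mul0r.
Qed.

Lemma mul_mx_tr_select q (X : 'M[R]_(q, p)) u i :
  (X *m (select_mx f)^T) u i = X u (f i).
Proof.
rewrite !mxE (bigD1 (f i)) //= !mxE eqxx mulr1 big1 ?addr0 // => v /negPf vi.
by rewrite !mxE vi mulr0.
Qed.

Hypothesis f_inj : injective f.

Lemma select_mx_trK : select_mx f *m (select_mx f)^T = 1%:M.
Proof.
by apply/matrixP=> i j; rewrite mul_select_mx !mxE (inj_eq f_inj).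
Qed.

Lemma tr_select_mul q (X : 'M[R]_(k, q)) i j :
  ((select_mx f)^T *m X) (f i) j = X i j.
Proof.
rewrite !mxE (bigD1 i) //= !mxE eqxx mul1r big1 ?addr0 // => u /negPf ui.
by rewrite !mxE (inj_eq f_inj) eq_sym ui mul0r.
Qed.

Lemma tr_select_mul0 q (X : 'M[R]_(k, q)) u j :
  u \notin codom f -> ((select_mx f)^T *m X) u j = 0.
Proof.
move=> uf; rewrite !mxE big1 // => i _; rewrite !mxE.
by case: eqP => [ui|_]; rewrite ?mul0r //; case/negP: uf; rewrite ui codom_f.
Qed.

Lemma tr_select_mulE u v :
  ((select_mx f)^T *m select_mx f) u v = ((u == v) && (u \in codom f))%:R.
Proof.
have [/codomP[i ->]|uf] := boolP (u \in codom f).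
  by rewrite tr_select_mul mxE eq_sym andbT.
by rewrite tr_select_mul0 // andbF.
Qed.

End Selection.

(** Let S be the image of [f], and let [h] increase along every arc that ends
    outside S, so that S meets all cycles of the weighted digraph [A]. Row u
    of [Y] lists the weights of the walks from u up to their first visit to S,
    the visit of u itself included. The hypothesis on [Y] then says that
    [1 - C] holds the weights of the first returns to S, and the determinant of
    [1 - t A] only depends on those: what remains of it off S is
    unitriangular. *)
Lemma det_first_return (R : comPzRingType) k p (A : 'M[R]_p) (t : R)
    (f : 'I_k -> 'I_p) (h : 'I_p -> nat) (Y : 'M[R]_(p, k)) (C : 'M[R]_k) :
  injective f ->
  (forall u v, v \notin codom f -> A u v != 0 -> (h u < h v)%N) ->
  select_mx R f *m Y = 1%:M ->
  (1%:M - t *: A) *m Y = (select_mx R f)^T *m C ->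
  \det (1%:M - t *: A) = \det C.
Proof.
move=> f_inj hA SY MY; have SS := select_mx_trK R f_inj.
rewrite (det_reduction SS SY MY); set D := _^T *m _; set Z := _ + D.
have DE u v : D u v = ((u == v) && (u \in codom f))%:R by apply: tr_select_mulE.
clearbody D; have ZE u v :
    Z u v = if v \in codom f then (u == v)%:R else (1%:M - t *: A) u v.
  rewrite /Z mulmxBr mulmx1; set M := 1%:M - _.
  have -> : (M - M *m D + D) u v = M u v - (M *m D) u v + D u v by rewrite !mxE.
  have -> : (M *m D) u v = M u v * (v \in codom f)%:R.
    rewrite mxE (bigD1 v) //= DE eqxx big1 ?addr0 // => w /negPf wv.
    by rewrite DE wv mulr0.
  rewrite DE; have [vf|vf] := boolP (v \in codom f).
    by rewrite mulr1 subrr add0r; case: eqP => [->|//]; rewrite vf.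
  by rewrite mulr0 subr0; case: eqP => [->|_]; rewrite ?(negPf vf) addr0.
have A0 u : u \notin codom f -> A u u = 0.
  by move=> uf; apply: contraTeq isT => /(hA _ _ uf); rewrite ltnn.
rewrite (@det_graded _ _ h) => [|u v uv].
  rewrite big1 ?mul1r // => u _; rewrite ZE eqxx !mxE eqxx.
  by case: ifPn => // /A0 ->; rewrite mulr0 subr0.
rewrite ZE (negPf uv); case: ifPn => [|vf]; first by rewrite eqxx.
rewrite !mxE (negPf uv) sub0r oppr_eq0 => tA; apply: hA => //.
by apply: contraNneq tA => ->; rewrite mulr0.
Qed.

(** * The polynomials counting disjoint cycles *)

(** For j >= 2 the coefficient of (- s) ^ k is the number of sets of k pairwise
    disjoint cycles among the r = j - 2 cycles that make up the digraph. *)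
Fixpoint cycle_poly (R : pzRingType) (s : R) (j : nat) : R :=
  match j with
  | (j'.+2 as j2).+1 => cycle_poly s j2 - s * cycle_poly s j'
  | _ => 1
  end.

Arguments cycle_poly : simpl never.

Lemma cycle_polyE (R : pzRingType) (s : R) j :
  cycle_poly s j.+3 = cycle_poly s j.+2 - s * cycle_poly s j.
Proof. by []. Qed.

(** The polynomial y ^ j * cycle_poly (1 / y) j. The exponent j exceeds
    the degree of [cycle_poly] when j > 0, at the sole cost of additional roots
    at 0, and it keeps the recurrence homogeneous. *)
Fixpoint reciprocal (F : fieldType) (j : nat) : {poly F} :=
  match j with
  | (j'.+2 as j2).+1 => 'X * reciprocal F j2 - 'X^2 * reciprocal F j'
  | _ => 'X^j
  end.

Arguments reciprocal : simpl never.

Lemma reciprocalE (F : fieldType) j :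
  reciprocal F j.+3 = 'X * reciprocal F j.+2 - 'X^2 * reciprocal F j.
Proof. by []. Qed.

Lemma horner_reciprocal (F : fieldType) (y : F) j : y != 0 ->
  (reciprocal F j).[y] = y ^+ j * cycle_poly y^-1 j.
Proof.
move=> y0; suff: [/\ (reciprocal F j).[y] = y ^+ j * cycle_poly y^-1 j,
  (reciprocal F j.+1).[y] = y ^+ j.+1 * cycle_poly y^-1 j.+1 &
  (reciprocal F j.+2).[y] = y ^+ j.+2 * cycle_poly y^-1 j.+2] by case.
elim: j => [|j [IH0 IH1 IH2]];
  first by rewrite /reciprocal /cycle_poly !hornerE.
split=> //; rewrite cycle_polyE reciprocalE !hornerE IH2 IH0.
rewrite !exprS; set c := cycle_poly _ j.+2; set d := cycle_poly _ j.
by field.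
Qed.

Lemma poly_eq_nonzero (F : numFieldType) (p q : {poly F}) :
  (forall y : F, y != 0 -> p.[y] = q.[y]) -> p = q.
Proof.
move=> pq; apply/eqP; rewrite -subr_eq0; apply/negPn/negP => pq0.
have := max_poly_roots pq0 (rs := [seq i.+1%:R | i <- iota 0 (size (p - q))]).
rewrite size_map size_iota ltnn => H; suff: false by []; apply: H => //.
  by apply/allP=> _ /mapP[i _ ->];
    rewrite /root !hornerE pq ?subrr // pnatr_eq0.
by rewrite map_inj_uniq ?iota_uniq // => i j /eqP; rewrite eqr_nat eqSS => /eqP.
Qed.

Section Complex.
Variable C : numClosedFieldType.
Implicit Types (a b s z w x : C) (p f g h : {poly C}).

Lemma Im_inv_lt0 z : 0 < 'Im z -> 'Im z^-1 < 0.
Proof.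
move=> z0; have n0 : z != 0.
  by apply: contraTneq z0 => ->; rewrite raddf0 ltxx.
by rewrite ImV mulNr oppr_lt0 divr_gt0 // exprn_gt0 // normr_gt0.
Qed.

Lemma Im_inv_gt0 z : 'Im z < 0 -> 0 < 'Im z^-1.
Proof.
move=> z0; have : 'Im (z^*)^-1 < 0 by apply: Im_inv_lt0;
  rewrite Im_conj oppr_gt0.
by rewrite -fmorphV Im_conj oppr_lt0.
Qed.

Lemma Im_inv_ge0 z : 'Im z <= 0 -> 0 <= 'Im z^-1.
Proof.
by rewrite ImV mulNr oppr_ge0 => z0; rewrite mulr_le0_ge0 // invr_ge0 exprn_ge0.
Qed.

Lemma Im_lt0_of_inv z : 0 < 'Im z^-1 -> 'Im z < 0.
Proof. by move/Im_inv_lt0; rewrite invrK. Qed.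

(** With a and b the ratios of consecutive values of [cycle_poly], the next
    ratio is 1 / d. The inverses of the four other products are 1 / a - s b,
    1 / (a b) - s, 1 / s - a b and 1 / (s a) - b: each is an upper number minus
    a lower one, and inversion exchanges the half-planes. *)
Lemma ratio_step s a b : 'Im s < 0 ->
    'Im a <= 0 -> 'Im (a * b) <= 0 -> 'Im (s * b) < 0 -> 'Im b <= 0 ->
    'Im (s * a) < 0 -> 'Im (s * a * b) < 0 ->
  let d := 1 - s * a * b in
  [/\ d != 0, 'Im d^-1 < 0, 'Im (d^-1 * a) < 0, 'Im (d^-1 * (a * b)) < 0 &
      'Im (s * d^-1) < 0 /\ 'Im (s * d^-1 * a) < 0].
Proof.
move=> s0 a0 ab0 sb0 b0 sa0 sab0 d.
have nz z : 'Im z < 0 -> z != 0.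
  by apply: contraTneq => ->; rewrite (Creal_ImP _ _) ?ltxx ?rpred0.
have Imd : 0 < 'Im d.
  by rewrite /d raddfB /= (Creal_ImP 1 _) ?rpred1 // sub0r oppr_gt0.
have d0 : d != 0 by rewrite -invr_eq0; apply: nz; apply: Im_inv_lt0.
have [s_n sa_n sab_n] : [/\ s != 0, s * a != 0 & s * a * b != 0].
  by split; exact: nz.
have a_n : a != 0 by apply: contraNneq sa_n => ->; rewrite mulr0.
have b_n : b != 0 by apply: contraNneq sab_n => ->; rewrite mulr0.
have key z w : z != 0 -> 0 <= 'Im z^-1 -> 'Im w <= 0 -> 'Im z^-1 - 'Im w != 0 ->
    d / z = z^-1 - w -> 'Im (d^-1 * z) < 0.
  move=> z0 z1 w0 ne e; apply: Im_lt0_of_inv; rewrite invfM invrK e raddfB /=.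
  by rewrite lt0r ne subr_ge0 (le_trans w0).
have lt_ne z w : 0 <= z -> w < 0 -> z - w != 0 :> C.
  by move=> z0 w0; rewrite gt_eqF // subr_gt0 (lt_le_trans w0).
have lt_ne' z w : 0 < z -> w <= 0 -> z - w != 0 :> C.
  by move=> z0 w0; rewrite gt_eqF // subr_gt0 (le_lt_trans w0).
split=> //; first exact: Im_inv_lt0.
- apply: (key a (s * b)) => //;
    rewrite ?Im_inv_ge0 ?(ltW sb0) ?lt_ne ?Im_inv_ge0 //.
  by rewrite /d; field.
- apply: (key _ s);
    rewrite ?mulf_neq0 ?Im_inv_ge0 ?(ltW s0) ?lt_ne ?Im_inv_ge0 //.
  by rewrite /d; field; apply/andP.
split; rewrite ?[s * _]mulrC -?mulrA.
  apply: (key _ (a * b)); rewrite ?Im_inv_ge0 ?(ltW s0) ?lt_ne' ?Im_inv_gt0 //.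
  by rewrite /d; field.
apply: (key _ b); rewrite ?Im_inv_ge0 ?(ltW sa0) ?lt_ne' ?Im_inv_gt0 //.
by rewrite /d; field; apply/andP.
Qed.

(** The ratios start from the real number 1, whence the weak inequalities for
    the products without the factor s. *)
Lemma cycle_poly_half_plane s j : 'Im s < 0 ->
  let c := cycle_poly s in
  [/\ c j.+3 != 0, 'Im (c j.+2 / c j.+3) <= 0, 'Im (c j.+1 / c j.+3) <= 0 &
     'Im (c j / c j.+3) <= 0].
Proof.
move=> s0 c.
pose inv i := [/\ c i.+1 != 0, c i.+2 != 0, 'Im (c i.+1 / c i.+2) <= 0,
  'Im (c i / c i.+1) <= 0 & 'Im (c i / c i.+2) <= 0] /\
  [/\ 'Im (s * (c i.+1 / c i.+2)) < 0, 'Im (s * (c i / c i.+1)) < 0 &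
  'Im (s * (c i / c i.+2)) < 0].
have step i : inv i -> [/\ inv i.+1, 'Im (c i.+1 / c i.+3) <= 0 &
     'Im (c i / c i.+3) <= 0].
  case=> -[c1 c2 a0 b0 ab0] [sa0 sb0 sab0].
  have abE : c i / c i.+2 = c i.+1 / c i.+2 * (c i / c i.+1).
    by field; apply/andP.
  rewrite abE in ab0 sab0; rewrite [s * (_ * _)]mulrA in sab0.
  have [d0 d1 d2 d3 [d4 d5]] := ratio_step s0 a0 ab0 sb0 b0 sa0 sab0.
  set d := 1 - _ in d0 d1 d2 d3 d4 d5.
  have c3 : c i.+3 = d * c i.+2.
    rewrite /c cycle_polyE -!/(c _) /d; field; apply/andP; split=> //.
  have c3_n : c i.+3 != 0 by rewrite c3 mulf_neq0.
  have e1 : c i.+2 / c i.+3 = d^-1 by rewrite c3; field; apply/andP.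
  have e2 : c i.+1 / c i.+3 = d^-1 * (c i.+1 / c i.+2).
    by rewrite c3; field; apply/andP.
  have e3 : c i / c i.+3 = d^-1 * (c i.+1 / c i.+2 * (c i / c i.+1)).
    by rewrite c3; field; rewrite c1 c2 d0.
  rewrite /inv e1 e2 e3 !(ltW d1, ltW d2, ltW d3); split=> //.
  by split; split=> //; rewrite mulrA.
have inv0 : inv 0%N.
  by rewrite /inv /c /cycle_poly !divr1 !mulr1 oner_neq0 (Creal_ImP 1 _)
    ?rpred1.
have invj : inv j by elim: j => // i /step[].
by have [[[_ ? ? _ _] _] ? ?] := step _ invj.
Qed.

Lemma cycle_poly_conj s j : (cycle_poly s j)^* = cycle_poly s^* j.
Proof.
suff: [/\ (cycle_poly s j)^* = cycle_poly s^* j,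
  (cycle_poly s j.+1)^* = cycle_poly s^* j.+1 &
  (cycle_poly s j.+2)^* = cycle_poly s^* j.+2] by case.
elim: j => [|j [IH0 IH1 IH2]]; first by rewrite /cycle_poly rmorph1.
by split=> //; rewrite !cycle_polyE rmorphB rmorphM /= IH2 IH0.
Qed.

(** Nonreal zeros are excluded by [cycle_poly_half_plane] and conjugation. For
    s <= 0 the recurrence only adds nonnegative terms. *)
Lemma cycle_poly_root_gt0 s j : cycle_poly s j = 0 -> 0 < s.
Proof.
move=> sj0.
have Im0 z : cycle_poly z j = 0 -> 0 <= 'Im z.
  move=> zj0; rewrite real_leNgt ?Creal_Im ?rpred0 //; apply/negP => z0.
  case: j zj0 {sj0} => [|[|[|j]]] zj0.
  1-3: by have := oner_neq0 C; rewrite -zj0 eqxx.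
  by have [] := cycle_poly_half_plane j z0; rewrite zj0 eqxx.
have sR : s \is Num.real.
  apply/Creal_ImP/eqP; rewrite eq_le Im0 // andbT -oppr_ge0 -Im_conj.
  by apply: Im0; rewrite -cycle_poly_conj sj0 rmorph0.
rewrite real_ltNge ?rpred0 //; apply: contra_eqN sj0 => s0.
suff: [/\ 0 < cycle_poly s j, 0 < cycle_poly s j.+1 & 0 < cycle_poly s j.+2].
  by case=> /lt0r_neq0.
elim: j {Im0} => [|j [IH0 IH1 IH2]]; first by rewrite /cycle_poly !ltr01.
by split=> //; rewrite cycle_polyE addrC ltr_wpDl // -mulNr mulr_ge0 ?oppr_ge0
  // ltW.
Qed.

(** As s is nonzero, the recurrence can be run backwards down to the value 1. *)
Lemma cycle_poly_no_three_zeros s j : s != 0 ->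
  [|| cycle_poly s j != 0, cycle_poly s j.+1 != 0 | cycle_poly s j.+2 != 0].
Proof.
move=> s0; elim: j => [|j]; first by rewrite oner_neq0.
apply: contraLR; rewrite !negb_or !negbK => /and3P[/eqP c1 /eqP c2].
by rewrite cycle_polyE c2 sub0r oppr_eq0 mulf_eq0 (negPf s0) /= => ->;
  rewrite c1 eqxx.
Qed.

Lemma Im_pos_near0 p : 0 < 'Im p.[0] -> exists2 e, 0 < e & 0 < 'Im p.[e].
Proof.
set d := 'Im _ => d0; have [|q pE] := factor_theorem (p - p.[0]%:P) 0 _.
  by rewrite /root !hornerE subrr.
pose M := \sum_(i < size q) `|q`_i|.
have M0 : 0 <= M by apply: sumr_ge0.
have dM0 : 0 < d + M by rewrite ltr_wpDr.
exists (d / (d + M)); first by rewrite divr_gt0.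
set e := d / _; have e0 : 0 < e by rewrite divr_gt0.
have e1 : e <= 1 by rewrite ler_pdivrMr // mul1r lerDl.
have -> : p = q * 'X + p.[0]%:P by rewrite -[p in LHS](subrK p.[0]%:P) pE subr0.
rewrite hornerMXaddC raddfD /= -/d.
have : `|'Im (q.[e] * e)| < d.
  apply: (@le_lt_trans _ _ (M * e)); last first.
    by rewrite mulrA ltr_pdivrMr // mulrC ltr_pM2l // ltrDr.
  have ImRe z : `|'Im z| <= `|z|.
    by rewrite -normrN -ReMil -[`|z|]mul1r -(normCi C) -normrM
      leif_normC_Re_Creal.
  apply: le_trans (ImRe _) _.
  rewrite normrM (gtr0_norm e0) ler_wpM2r ?(ltW e0) // horner_coef.
  apply: le_trans (ler_norm_sum _ _ _) _; apply: ler_sum => i _.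
  by rewrite normrM normrX (gtr0_norm e0) ler_piMr // exprn_ile1 // ltW.
by rewrite real_ltr_norml ?Creal_Im // => /andP[+ _]; rewrite -subr_gt0 opprK.
Qed.

(** At a zero x of f of order k, the quotient g / f behaves as c (z - x) ^ (- k)
    up to a positive factor, with c real and nonzero. If k >= 2, the k-th powers
    of the numbers in the upper half-plane include all the nonreal ones, so
    that there is a direction w with w ^ k = - i c, along which the quotient has
    argument close to that of i. *)
Lemma mup_le1_of_half_plane f g x :
    map_poly Num.conj f = f -> map_poly Num.conj g = g -> x \is Num.real ->
    f != 0 -> g.[x] != 0 ->
    (forall z, 0 < 'Im z -> 'Im (g.[z] / f.[z]) <= 0) ->
  (mup x f <= 1)%N.
Proof.
move=> fR gR xR f0 gx0 Imgf.
have [k [h]] := multiplicity_XsubC f x; rewrite f0 /= => hx0 fE.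
have -> : mup x f = k by rewrite fE mupMr // mup_XsubCX eqxx.
have xC := CrealP xR; rewrite leqNgt; apply/negP => k2.
have hR : map_poly Num.conj h = h.
  apply: (mulIf (monic_neq0 (monic_exp k (monicXsubC x)))).
  rewrite -fE -[RHS]fR fE rmorphM rmorphXn /= rmorphB /= map_polyX map_polyC /=.
  by rewrite xC.
have conj_horner p z : map_poly Num.conj p = p -> p.[z]^* = p.[z^*].
  by move=> pR; rewrite -horner_map pR.
pose c := g.[x] * h.[x].
have cR : c \is Num.real.
  by apply/CrealP; rewrite rmorphM /= !conj_horner // xC.
have c0 : c != 0 by rewrite mulf_neq0.
(* The chosen k-th root has a nonnegative imaginary part because k >= 2; this
   part is not 0 since w ^ k is not real. *)
pose w := k.-root (- 'i * c).
have wk : w ^+ k = - 'i * c by rewrite rootCK // (ltn_trans _ k2).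
have Imw : 0 < 'Im w.
  rewrite lt0r Im_rootC_ge0 // andbT; apply: contraNneq c0 => /Creal_ImP wR.
  have /Creal_ImP := rpredX k wR; rewrite wk mulNr raddfN /= ImMil.
  by move/eqP; rewrite oppr_eq0 (Creal_ReP _ cR).
(* [Phi e] is g(z) times the conjugate of f(z), divided by e ^ k, at the point
   z = x + w e; as a polynomial in e it also makes sense at e = 0. *)
pose Phi :=
  (g \Po (x%:P + w *: 'X)) * (h \Po (x%:P + w^* *: 'X)) * ((w^*) ^+ k)%:P.
have PhiE e : Phi.[e] = g.[x + w * e] * h.[x + w^* * e] * (w^*) ^+ k.
  by rewrite /Phi !hornerM !horner_comp !hornerE.
have Phi0 : 0 < 'Im Phi.[0].
  rewrite PhiE !mulr0 addr0 -rmorphXn /= wk rmorphM rmorphN /= conjCi opprK.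
  have ccR : c * c \is Num.real by rewrite realM.
  rewrite (CrealP cR) -/c mulrCA ImMil (Creal_ReP _ ccR).
  by rewrite -expr2 real_exprn_even_gt0.
have [e e0 Phie] := Im_pos_near0 Phi0.
have eC : e^* = e by apply/CrealP; rewrite realE (ltW e0).
pose z := x + w * e.
have Imz : 0 < 'Im z.
  by rewrite raddfD /= (Creal_ImP _ xR) add0r ImMr ?mulr_gt0 // realE (ltW e0).
have zC : z^* = x + w^* * e by rewrite rmorphD rmorphM /= xC eC.
have e_k : 0 < e ^+ k by rewrite exprn_gt0.
have key : Phi.[e] * e ^+ k = g.[z] / f.[z] * `|f.[z]| ^+ 2.
  have [fz0|fz0] := eqVneq f.[z] 0.
    rewrite fz0 invr0 mulr0 mul0r; apply/eqP;
      rewrite mulf_eq0 (gt_eqF e_k) orbF.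
    have : f.[z] == 0 by rewrite fz0.
    rewrite fE hornerM horner_exp hornerXsubC /z [x + _]addrC addrK mulf_eq0
      expf_eq0.
    rewrite mulf_eq0 (gt_eqF e0) orbF => /orP[/eqP hz0|/andP[_ /eqP w0]];
      last first.
      by move: Imw; rewrite w0 raddf0 ltxx.
    by rewrite PhiE -zC -conj_horner // /z addrC hz0 rmorph0 mulr0 mul0r.
  rewrite normCK mulrA divfK // PhiE -/z -zC conj_horner // fE hornerM
    horner_exp.
  rewrite !hornerE; set u := h.[_].
  by rewrite zC [x + _]addrC addrK exprMn -[LHS]mulrA.
have : 0 < 'Im (g.[z] / f.[z] * `|f.[z]| ^+ 2).
  by rewrite -key ImMr ?mulr_gt0 // realE (ltW e_k).
by rewrite ImMr ?rpredX ?normr_real // le_gtF // mulr_le0_ge0 ?Imgf ?exprn_ge0.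
Qed.

Lemma map_conj_reciprocal j :
  map_poly Num.conj (reciprocal C j) = reciprocal C j.
Proof.
suff: [/\ map_poly Num.conj (reciprocal C j) = reciprocal C j,
  map_poly Num.conj (reciprocal C j.+1) = reciprocal C j.+1 &
  map_poly Num.conj (reciprocal C j.+2) = reciprocal C j.+2] by case.
elim: j => [|j [IH0 IH1 IH2]]; first by rewrite /reciprocal !map_polyXn.
by split=> //; rewrite !reciprocalE rmorphB !rmorphM /= map_polyX IH2 IH0.
Qed.

Lemma reciprocal_neq0 j : reciprocal C j != 0.
Proof.
apply/negP => /eqP W0; have := horner_reciprocal j (y := -1 : C).
rewrite W0 hornerC oppr_eq0 oner_neq0 => /(_ isT)/esym/eqP.
rewrite mulf_eq0 expf_eq0 oppr_eq0 oner_eq0 andbF /= =>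
  /eqP/cycle_poly_root_gt0.
by rewrite invrN1 oppr_gt0 ltr10.
Qed.

(** If c_j vanishes at 1 / x, one of the three preceding values does not; its
    quotient by c_j satisfies the half-plane bound, which passes to
    y ^ (j - i) * reciprocal i / reciprocal j since inversion exchanges the
    half-planes. *)
Lemma reciprocal_nonzero_root j x : x != 0 -> root (reciprocal C j) x ->
  0 < x /\ mup x (reciprocal C j) = 1%N.
Proof.
move=> x0 Wx; have cx : cycle_poly x^-1 j = 0.
  move: Wx; rewrite /root horner_reciprocal // mulf_eq0 expf_eq0 (negPf x0)
    andbF.
  by move/eqP.
have xgt0 : 0 < x by rewrite -invr_gt0 (cycle_poly_root_gt0 cx).
have xR : x \is Num.real by rewrite realE (ltW xgt0).
split=> //; apply/eqP; rewrite eqn_leq.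
rewrite [X in _ && X]mup_geq ?reciprocal_neq0 // expr1 dvdp_XsubCl Wx andbT.
case: j cx {Wx} => [|[|[|j]]] cx; try by have := oner_neq0 C; rewrite -cx eqxx.
have half i : (i <= j.+3)%N ->
    (forall s, 'Im s < 0 -> 'Im (cycle_poly s i / cycle_poly s j.+3) <= 0) ->
    cycle_poly x^-1 i != 0 -> (mup x (reciprocal C j.+3) <= 1)%N.
  move=> ij Imc ci.
  apply: (@mup_le1_of_half_plane _ ('X^(j.+3 - i) * reciprocal C i)).
  - exact: map_conj_reciprocal.
  - by rewrite rmorphM /= map_polyXn map_conj_reciprocal.
  - exact: xR.
  - exact: reciprocal_neq0.
  - by rewrite hornerM hornerXn horner_reciprocal // !mulf_neq0 // expf_neq0.
  move=> z Imz; have z0 : z != 0.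
    by apply: contraTneq Imz => ->; rewrite raddf0 ltxx.
  rewrite hornerM hornerXn !horner_reciprocal // mulrA -exprD subnK //.
  rewrite -mulf_div divff ?expf_neq0 // mul1r; apply: Imc; exact: Im_inv_lt0.
have /or3P[] := cycle_poly_no_three_zeros j (invr_neq0 x0); apply: half;
  try lia; by move=> s /(cycle_poly_half_plane j)[].
Qed.

End Complex.

(** * Arcs and layers of the digraph *)

Lemma mem_arcs a b (u v : nat) :
  ((u, v) \in arcs a b) = (v == u.+1) && (a <= u <= b)%N.
Proof.
apply/mapP/andP => [[j]|[/eqP -> ab]];
  last by exists u; rewrite // mem_index_iota ltnS.
by rewrite mem_index_iota ltnS => ab [-> ->].
Qed.

Lemma mem_edgesF m i (u v : nat) : (0 < m)%N ->
  ((u, v) \in edgesF m.+2 i) = [|| (u == i * m + 2)%N && (v == i * m + m + 3)%N,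
   (v == u.+1) && (i * m + m + 3 <= u <= i * m + m + m + 1)%N |
   (u == i * m + m + m + 2)%N && (v == i * m + m + 2)%N].
Proof.
move=> m0; rewrite /edgesF in_cons mem_cat mem_arcs mem_seq1 !xpair_eqE mulnSr
  mulnSr.
by congr [|| _ && _, _ && _ | _ && _]; lia.
Qed.

Lemma mem_edges m r (u v : nat) : (0 < m)%N -> (0 < r)%N ->
  (u, v) \in edges m.+2 r <->
  [\/ v = u.+1 /\ (1 <= u <= m.+1)%N, u = m.+2 /\ v = 1%N,
      (1 < r)%N /\ [\/ u = 1%N /\ v = m.+3,
        v = u.+1 /\ (m + 3 <= u <= m + m + 1)%N | u = (m + m + 2)%N /\ v = m.+2]
    | exists2 i, (1 <= i <= r - 2)%N & (u, v) \in edgesF m.+2 i].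
Proof.
move=> m0 r0.
have edges1E : ((u, v) \in edges1 m.+2) =
    (v == u.+1) && (1 <= u <= m.+1)%N || (u == m.+2) && (v == 1%N).
  by rewrite /edges1 mem_cat mem_arcs inE xpair_eqE; congr (_ && _ || _); lia.
rewrite /edges; case: eqP => [-> | r1].
  rewrite edges1E; split.
    by case/orP=> /andP[/eqP ? ?];
      [constructor 1 | constructor 2; split => //; apply/eqP].
  case=> [[-> H]|[-> ->]| [] // | [i /andP[i1 i2] _]] //;
    rewrite ?H ?eqxx ?orbT //.
  by have := leq_trans i1 i2.
have flatE :
    (u, v) \in flatten [seq edgesF m.+2 i | i <- index_iota 1 (r - 2).+1] <->
    exists2 i, (1 <= i <= r - 2)%N & (u, v) \in edgesF m.+2 i.
  split=> [/flatten_mapP[k]|[i ir uv]].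
    by rewrite mem_index_iota ltnS => ? ?; exists k.
  by apply/flatten_mapP; exists i; rewrite // mem_index_iota ltnS.
rewrite mem_cat; split.
  case/orP => [|/flatE]; last by constructor 4.
  rewrite /edges2 mem_cat edges1E in_cons mem_cat mem_arcs mem_seq1 !xpair_eqE.
  case/or4P => [/orP[]/andP[/eqP ? ?]|/andP[/eqP ? /eqP ?]|
    /andP[/eqP ? ?]|/andP[/eqP ? /eqP ?]].
  - by constructor 1.
  - by constructor 2; split => //; apply/eqP.
  - by constructor 3; split; [lia | constructor 1; lia].
  - by constructor 3; split; [lia | constructor 2; lia].
  - by constructor 3; split; [lia | constructor 3; lia].
case=> [H|H|[_ H]|H]; apply/orP; [left|left|left|by right; apply/flatE].
- by rewrite /edges2 mem_cat edges1E; case: H => -> ->; rewrite eqxx.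
- by rewrite /edges2 mem_cat edges1E; case: H => -> ->; rewrite !eqxx orbT.
rewrite /edges2 mem_cat edges1E in_cons mem_cat mem_arcs mem_seq1 !xpair_eqE.
by apply/or4P; case: H => -[-> H];
  [constructor 2 | constructor 3 | constructor 4]; lia.
Qed.

Section Digraph.
Local Open Scope nat_scope.

Lemma block_lt m i j : i < j -> i * m + m <= j * m.
Proof. by move=> ij; rewrite -mulSnr leq_mul2r ij orbT. Qed.

(** The arc from [branch m i.+1] to [branch m i] lies on the cycle of index i,
    counted from 0, and on the next one if there is one. All other
    vertices have a single outgoing arc. *)
Definition branch m i := i * m + (0 < i).

(** Vertices are numbered from 0, unlike in [edges]. *)
Definition adj m r (u v : nat) := (u.+1, v.+1) \in edges m.+2 r.

Section Arcs.
Variables (m r : nat).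
Hypotheses (m0 : 0 < m) (r0 : 0 < r).

Lemma adj_root v : adj m r 0 v = (v == 1) || (1 < r) && (v == m.+2).
Proof.
apply/idP/idP => [/(mem_edges _ _ m0 r0)|].
  case=> [||[? []]|[k ? ]]; try lia.
  rewrite mem_edgesF //; lia.
case/orP=> [/eqP->|/andP[r1 /eqP->]]; apply/(mem_edges _ _ m0 r0).
  by constructor 1; lia.
by constructor 3; split=> //; constructor 1; lia.
Qed.

Lemma adj_branch i v : 0 < i <= r ->
  adj m r (branch m i) v
    = (v == branch m i.-1) || (i.+2 <= r) && (v == i.+1 * m + 2).
Proof.
case: i => // i ir; rewrite /branch /= mulSn.
apply/idP/idP => [/(mem_edges _ _ m0 r0)|].
  case=> [|[]|[r1 [[]||[]]]|[k kr ]].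
  - by lia.
  - case: i ir => [|i]; first by lia.
    by have := @block_lt m 0 i.+1 isT; lia.
  - lia.
  - case: i ir => [|[|i]] ir; [lia | lia |].
    by have := @block_lt m 1 i.+2 isT; lia.
  - case: i ir => [|[|i]] ir; [lia | rewrite /=; lia |].
    by have := @block_lt m 1 i.+2 isT; lia.
  rewrite mem_edgesF // => /or3P[] /andP[].
  - have [/(@block_lt m)|/(@block_lt m)|?] := ltngtP i.+1 k; lia.
  - have [/(@block_lt m)|/(@block_lt m)|?] := ltngtP i k.
    + lia.
    + have [/(@block_lt m)|/(@block_lt m)|?] := ltngtP i k.+1; lia.
    + lia.
  - have [/(@block_lt m)|/(@block_lt m)|?] := ltngtP i k.+1; lia.
case/orP=> [/eqP->|/andP[r1 /eqP->]]; apply/(mem_edges _ _ m0 r0).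
  case: i ir => [|[|i]] ir.
  - by constructor 2; lia.
  - by constructor 3; split; [lia | constructor 3; lia].
  constructor 4; exists i.+1; first by lia.
  by rewrite mem_edgesF //; lia.
constructor 4; exists i.+1; first by lia.
by rewrite mem_edgesF //; lia.
Qed.

Lemma adj_interior u v :
  u < r * m + 2 -> (forall i, i <= r -> u != branch m i) ->
  adj m r u v = (v == u.+1).
Proof.
move=> ur ub; apply/idP/eqP => [/(mem_edges _ _ m0 r0)|->].
  case=> [|[]|[r1 [[]||[]]]|[k kr ]].
  - lia.
  - by have := ub 1 r0; rewrite /branch; lia.
  - by have := ub 0 isT; rewrite /branch; lia.
  - lia.
  - by have := ub 2 r1; rewrite /branch; lia.
  rewrite mem_edgesF // => /or3P[] /andP[].
  - have kr' : k <= r by lia.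
    by have := ub k kr'; rewrite /branch; lia.
  - lia.
  have kr' : k.+2 <= r by lia.
  by have := ub k.+2 kr'; rewrite /branch; lia.
apply/(mem_edges _ _ m0 r0).
have u0 : 0 < u by have := ub 0 isT; rewrite /branch; lia.
have um : u != m + 1 by have := ub 1 r0; rewrite /branch; lia.
have [um'|um'] := ltnP u m.+1; first by constructor 1; lia.
have [j [k [jr km uE]]] :
    exists j k, [/\ 0 < j < r, k + 1 < m & u = j * m + k + 2].
  have := divn_eq (u - 2) m; have := ltn_pmod (u - 2) m0.
  set j := _ %/ _; set k := _ %% _ => km uE.
  have jr : j < r by rewrite /j ltn_divLR //; lia.
  have j0 : 0 < j by rewrite /j divn_gt0 //; lia.
  exists j, k; split; [by rewrite j0| | lia].
  by have := ub j.+1 jr; rewrite /branch; lia.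
case: j jr uE => [|[|j]] jr uE; first by lia.
  by constructor 3; split; [lia | constructor 2; lia].
constructor 4; exists j.+1; first by lia.
by rewrite mem_edgesF //; lia.
Qed.

End Arcs.

(** From a cycle to the next one the vertex numbers grow by m while the layers
    drop by 1, which is the same as growing by m + 1 modulo m + 2: hence the
    layer is the vertex number plus the index of the cycle. The truncated
    subtraction puts vertices 0 and 1 in the initial cycle. *)
Definition lay m u := (u + (u - 2) %/ m) %% m.+2.

Section Layers.
Variables (m r : nat).
Hypotheses (m0 : 0 < m) (r0 : 0 < r).

Lemma lay_interior j k :
  k < m -> lay m (j * m + k + 2) = (j * m.+1 + k + 2) %% m.+2.
Proof.
move=> km; rewrite /lay; have -> : j * m + k + 2 - 2 = j * m + k by lia.
by rewrite divnMDl // divn_small // addn0; congr (_ %% _); lia.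
Qed.

(** That is, the layer of [branch m i] is - i modulo m + 2. *)
Lemma lay_branch i : lay m (branch m i) = (i * m.+1) %% m.+2.
Proof.
rewrite /branch; case: i => [|i]; first by rewrite /lay div0n !mod0n.
have -> : i.+1 * m + (0 < i.+1) = i * m + m.-1 + 2 by lia.
by rewrite lay_interior ?prednK //; congr (_ %% _); lia.
Qed.

Lemma vertexP u : u < r * m + 2 ->
  [\/ exists2 i, i <= r & u = branch m i, u = 1 |
    exists j k, [/\ j < r, k.+1 < m & u = j * m + k + 2]].
Proof.
move=> ur; have [u2|u2] := ltnP u 2.
  case: u u2 {ur} => [|[|//]] _; last by constructor 2.
  by constructor 1; exists 0.
have := divn_eq (u - 2) m; have := ltn_pmod (u - 2) m0.
set j := _ %/ _; set k := _ %% _ => km uE.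
have jr : j < r by rewrite /j ltn_divLR //; lia.
have [km'|km'] := ltnP k.+1 m; first by constructor 3; exists j, k; split=> //;
  lia.
by constructor 1; exists j.+1; rewrite // /branch /=; lia.
Qed.

Lemma branch_neq1 i : 1 != branch m i.
Proof. by case: i => [|i]; rewrite /branch ?mulSn //; lia. Qed.

Lemma interior_neq_branch i j k : k.+1 < m -> j * m + k + 2 != branch m i.
Proof.
move=> km; rewrite /branch; case: i => [|i]; first by lia.
by have [/(@block_lt m)|/(@block_lt m)|->] := ltngtP i j; rewrite ?mulSn; lia.
Qed.

Lemma lay_adj u v :
  u < r * m + 2 -> adj m r u v -> lay m v = (lay m u).+1 %% m.+2.
Proof.
move=> u_lt; move: (u_lt).
case: (vertexP u_lt) => [[[|i] ir ->]|->|[j [k [jr km ->]]]] ur.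
- have -> : branch m 0 = 0 by [].
  rewrite adj_root // => /orP[/eqP->|/andP[_ /eqP->]];
    rewrite /lay /= ?subSS ?subn0.
    by rewrite !div0n !addn0 mod0n.
  by rewrite divnn m0 div0n !mod0n addn1 -addn1 modnDl.
- rewrite adj_branch // lay_branch -[(_ %% _).+1]addn1 modnDml
    => /orP[/eqP->|/andP[_ /eqP->]].
    rewrite lay_branch; symmetry; rewrite -(modnDr (i * _)); congr (_ %% _);
      lia.
  have -> : i.+2 * m + 2 = i.+2 * m + 0 + 2 by lia.
  rewrite lay_interior // -[RHS]modnDr; congr (_ %% _); lia.
- rewrite adj_interior // => [/eqP->|i _]; last exact: branch_neq1.
  by rewrite /lay div0n.
rewrite adj_interior // => [/eqP->|i _]; last exact: interior_neq_branch.
have -> : (j * m + k + 2).+1 = j * m + k.+1 + 2 by lia.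
rewrite !lay_interior ?(ltnW km) // -[(_ %% _).+1]addn1 modnDml;
  congr (_ %% _); lia.
Qed.

End Layers.

(** When all arcs are compatible with [f], the order of the arcs decides which
    vertices receive a layer, but not which layer they receive. *)
Lemma foldl_add_edge_consistent n (f : nat -> nat) es l :
  (forall e, e \in es -> f e.2 = (f e.1).+1 %% n) ->
  (forall v c, l v = Some c -> c = f v) ->
  forall v c, foldl (add_edge n) l es v = Some c -> c = f v.
Proof.
elim: es l => [|e es IH] l //= fes lf; apply: IH => [e' e'es|v c].
  by apply: fes; rewrite inE e'es orbT.
rewrite /add_edge; case: (l e.2) => [_|] /=; first exact: lf.
case: eqP => [-> | _]; last exact: lf.
case le1: (l e.1) => [d|] //= -[<-].
by rewrite (lf _ _ le1) fes // inE eqxx.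
Qed.

Lemma add_edge_mono n (l : nat -> option nat) e v : l v -> add_edge n l e v.
Proof.
by rewrite /add_edge; case le2: (l e.2) => [//|] /= lv; case: eqP => // ve;
  rewrite ve le2 in lv.
Qed.

Lemma add_edge_new n (l : nat -> option nat) e : l e.1 -> add_edge n l e e.2.
Proof.
rewrite /add_edge; case le2: (l e.2) => [c|] /=; first by rewrite le2.
by rewrite eqxx; case: (l e.1).
Qed.

Lemma foldl_add_edge_mono n es (l : nat -> option nat) v :
  l v -> foldl (add_edge n) l es v.
Proof. by elim: es l => //= e es IH l lv; apply/IH/add_edge_mono. Qed.

Lemma foldl_arcs_defined n (l : nat -> option nat) a b v :
  l a -> a <= v <= b.+1 ->
  foldl (add_edge n) l (arcs a b) v.
Proof.
move=> la /andP[av vb]; have : v <= a + (b.+1 - a) by lia.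
rewrite /arcs /index_iota; move: (b.+1 - a) => k {vb}.
elim: k a l la av => [|k IH] a l la av vk /=; first by have -> : v = a by lia.
have [->|va] := eqVneq v a; first exact/foldl_add_edge_mono/add_edge_mono.
by apply: IH; [exact: add_edge_new | lia | lia].
Qed.

(** Each new cycle leaves from a vertex that already has a layer. *)
Lemma layer_defined m r v :
  0 < m -> 0 < r -> 0 < v <= r * m + 2 -> layer m.+2 r v.
Proof.
move=> m0 r0 vr; rewrite /layer; set l0 := [fun _ : nat => _ with _ |-> _].
set F := foldl (add_edge _).
have D1 w : 0 < w <= m + 2 -> F l0 (edges1 m.+2) w.
  move=> wm; rewrite /F foldl_cat.
  by apply/foldl_add_edge_mono/foldl_arcs_defined; [by [] | lia].
rewrite /edges; case: eqP => [r1|r1]; first by apply: D1; lia.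
have D2 w : 0 < w <= 2 * m + 2 -> F l0 (edges2 m.+2) w.
  move=> wm; rewrite /edges2 /F foldl_cat -/F /=.
  have [/D1 dw|mw] := boolP (0 < w <= m + 2).
    exact/foldl_add_edge_mono/add_edge_mono.
  rewrite {1}/F foldl_cat; apply/foldl_add_edge_mono/foldl_arcs_defined;
    last lia.
  rewrite addn1; apply: (@add_edge_new _ _ (1, m.+3)); apply: D1; rewrite /=;
    lia.
rewrite /F foldl_cat -/F; set l2 := F _ _ in D2 *.
have Dk k w : 0 < w <= (k + 2) * m + 2 ->
    F l2 (flatten [seq edgesF m.+2 i | i <- index_iota 1 k.+1]) w.
  elim: k w => [|k IH] w wk; first by apply: D2; lia.
  have -> : index_iota 1 k.+2 = index_iota 1 k.+1 ++ [:: k.+1].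
    by rewrite /index_iota !subSS !subn0 -[X in iota 1 X = _]addn1 iotaD add1n.
  rewrite map_cat flatten_cat /F foldl_cat -/F.
  set l := F _ _ in IH *; rewrite /= cats0.
  have [/IH lw|kw] := boolP (0 < w <= (k + 2) * m + 2).
    exact: (foldl_add_edge_mono _ (edgesF m.+2 k.+1)).
  rewrite /F foldl_cat; apply/foldl_add_edge_mono/foldl_arcs_defined; last lia.
  by apply: (@add_edge_new _ _ (_, _)); apply: IH; rewrite /=; lia.
by apply: Dk; nia.
Qed.

Lemma edge_bounds m r u v : 0 < m -> 0 < r -> (u, v) \in edges m.+2 r ->
  0 < u <= r * m + 2 /\ 0 < v.
Proof.
move=> m0 r0 /(mem_edges _ _ m0 r0).
have rm : m <= r * m by rewrite -[m in m <= _]mul1n leq_mul2r r0 orbT.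
case=> [||[r1 H]|[k kr]]; try lia.
  have rm2 : 2 * m <= r * m by rewrite leq_mul2r r1 orbT.
  by case: H; lia.
have rmk : k.+2 * m <= r * m by rewrite leq_mul2r; lia.
by rewrite mem_edgesF //; lia.
Qed.

Lemma layerE m r v : 0 < m -> 0 < r -> 0 < v <= r * m + 2 ->
  layer m.+2 r v = Some (lay m v.-1).
Proof.
move=> m0 r0 vr; have := layer_defined m0 r0 vr;
  case lv: (layer _ _ _) => [c|//] _.
congr Some.
apply: (foldl_add_edge_consistent (f := lay m \o predn)) lv
  => [[u w] /= uw|w d /=].
  have [/andP[u0 ur] w0] := edge_bounds m0 r0 uw.
  apply: (lay_adj m0 r0); first by lia.
  by rewrite /adj !prednK.
by case: eqP => // -> [<-]; rewrite /lay div0n mod0n.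
Qed.

End Digraph.

(** * Cutting walks at the branch vertices *)

Lemma sum_delta (F : pzRingType) n k (g : nat -> F) :
  \sum_(j < n) (j == k :> nat)%:R * g j = (k < n)%N%:R * g k.
Proof.
case: ltnP => kn; last first.
  by rewrite mul0r big1 // => j _; rewrite ltn_eqF ?mul0r // (leq_trans _ kn).
rewrite (bigD1 (Ordinal kn)) //= eqxx big1 ?addr0 // => j jk.
by rewrite -[(_ == k)]/(j == Ordinal kn) (negPf jk) mul0r.
Qed.

(** [1 - return_mx] holds the first-return weights of the branch vertices: from
    i there is one arc to i - 1 and a path of length m to i + 2, and from 0 also
    a path of length m + 1 to 1. Paths to indices beyond r are absent from the
    matrix as from the digraph. *)
Definition return_mx (F : fieldType) (m r : nat) (t : F) : 'M[F]_r.+1 :=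
  \matrix_(i, j) ((j == i :> nat)%:R - t * (j.+1 == i :> nat)%:R
    - t ^+ m * (j == i.+2 :> nat)%:R
    - t ^+ m.+1 * ((i == 0%N :> nat) && (j == 1%N :> nat))%:R).

Lemma sum_return_mx (F : fieldType) m r (t : F) (i : 'I_r.+1) (g : nat -> F) :
  \sum_j return_mx m r t i j * g j
   = g i - t * ((0 < i)%N%:R * g i.-1) - t ^+ m * ((i.+2 < r.+1)%N%:R * g i.+2)
     - t ^+ m.+1 * ((i == 0%N :> nat)%:R * ((1 < r.+1)%N%:R * g 1%N)).
Proof.
have pr : (i.-1 < r.+1)%N by rewrite (leq_ltn_trans (leq_pred i)).
have -> : g i = (i < r.+1)%N%:R * g i by rewrite ltn_ord mul1r.
have -> : g i.-1 = (i.-1 < r.+1)%N%:R * g i.-1 by rewrite pr mul1r.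
rewrite -!sum_delta !mulr_sumr -!sumrB; apply: eq_bigr => j _; rewrite !mxE.
have -> : (j.+1 == i :> nat)%:R = (0 < i)%N%:R * (j == i.-1 :> nat)%:R :> F.
  by case: (nat_of_ord i) => [|k]; rewrite ?mul0r ?mul1r.
have -> : ((i == 0%N :> nat) && (j == 1%N :> nat))%:R
    = (i == 0%N :> nat)%:R * (j == 1%N :> nat)%:R :> F.
  by case: eqP; rewrite ?mul0r ?mul1r.
by rewrite !mulrBl !mulrA.
Qed.

(** The vector with entries t ^ i * c_(r - i) is sent to a multiple of the first
    basis vector: the recurrence cancels all other rows. The cofactor that
    Cramer's rule then requires is that of a triangular matrix with - t on the
    diagonal. *)
Lemma det_return_mx (F : fieldType) m r (t : F) : (0 < r)%N -> t != 0 ->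
  \det (return_mx m r t) = cycle_poly (t ^+ m.+2) r.+2.
Proof.
move=> r0 t0; set s := t ^+ m.+2; set c := cycle_poly s.
pose g j := t ^+ j * c (r - j)%N; pose v : 'cV[F]_r.+1 := \col_i g i.
have sE k : t ^+ m * t ^+ k.+2 = t ^+ k * s.
  by rewrite -!exprD; congr (_ ^+ _); lia.
have sE' k : t ^+ m.+1 * t ^+ k.+1 = t ^+ k * s.
  by rewrite -!exprD; congr (_ ^+ _); lia.
have Cv : return_mx m r t *m v = c r.+2 *: delta_mx 0 0.
  apply/matrixP=> i j; rewrite !mxE (ord1 j) eqxx andbT {j}.
  under eq_bigr => j _ do rewrite [v _ _]mxE.
  have r1 : (1 < r.+1)%N by [].
  rewrite sum_return_mx r1 mul1r -[i == 0]/(i == 0%N :> nat) {r1}.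
  case: i => -[|i] /= ir; rewrite ?mul1r ?mul0r ?mulr0 ?mulr1 ?subr0.
    case: r r0 {v ir} @g => [//|[|r]] _ g; rewrite /g ?subSS ?subn0.
      by rewrite mul0r mulr0 subr0 (mulrA _ _ (c _)) (sE' 0%N) expr0 !mul1r.
    have -> : (2 < r.+3)%N by lia.
    rewrite !mul1r !(mulrA _ _ (c _)) (sE 0%N) (sE' 0%N) expr0 !mul1r.
    rewrite /c !cycle_polyE -/c; ring.
  have [d rE] : exists d, r = (d + i.+1)%N.
    by exists (r - i.+1)%N; rewrite subnK.
  rewrite /g rE -addnS; have -> : (d + i.+1 - i = d.+1)%N by lia.
  rewrite addnK; case: d {rE} => [|[|d]].
  - have -> : (i.+3 < 0 + i.+2)%N = false by lia.
    by rewrite mul0r mulr0 subr0 (mulrA _ _ (c _)) -exprS; apply: subrr.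
  - have -> : (i.+3 < 1 + i.+2)%N = false by lia.
    by rewrite mul0r mulr0 subr0 (mulrA _ _ (c _)) -exprS; apply: subrr.
  have -> : (i.+3 < d.+2 + i.+2)%N by lia.
  have -> : (d.+2 + i.+1 - i.+3 = d)%N by lia.
  rewrite mul1r (mulrA (t ^+ m)) (sE i.+1) exprS.
  have -> : c d.+3 = c d.+2 - s * c d by rewrite /c cycle_polyE.
  ring.
have := det_cofactor_of_col Cv.
have -> : cofactor (return_mx m r t) 0 ord_max = t ^+ r.
  rewrite /cofactor -det_tr det_trig; last first.
    apply/is_trig_mxP => i j ij; rewrite !mxE lift_max lift0 /=.
    have [-> ->] : (i == j.+1 :> nat) = false /\ (i == j.+3 :> nat) = false.
      by split; apply/negbTE; lia.
    by rewrite eqSS ltn_eqF // !mulr0 !subr0.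
  under eq_bigr => i _.
    rewrite !mxE lift_max lift0 /= eqxx mulr1 mulr0 subr0.
    have [-> ->] : (i == i.+1 :> nat) = false /\ (i == i.+3 :> nat) = false.
      by split; apply/negbTE; lia.
    rewrite mulr0 subr0 sub0r.
    over.
  by rewrite prodr_const card_ord -exprMn mulrN mulN1r opprK.
rewrite mxE /g subnn => e; apply: (mulIf (expf_neq0 r t0)).
by move: e; rewrite mulr1.
Qed.

Definition adj_mx (F : fieldType) m r : 'M[F]_((r * m).+2) :=
  \matrix_(u, v) (adj m r u v)%:R.

(** The weight t ^ d if a walk from u first meets a branch vertex after d >= 0
    steps and this is the i-th one, and 0 otherwise. Between branch vertices the
    walk is forced; vertex 1 comes before the first complete block of length
    m. *)
Definition first_branch (F : fieldType) m (t : F) (u i : nat) : F :=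
  if u is u'.+1 then
    if u' is u''.+1 then t ^+ (m - (u'' %% m).+1) * (i == (u'' %/ m).+1)%:R
    else t ^+ m * (i == 1%N)%:R
  else (i == 0%N)%:R.

Section Branches.
Variables (F : fieldType) (m r : nat) (t : F).
Hypotheses (m0 : (0 < m)%N) (r0 : (0 < r)%N).

Let g := first_branch m t.

Lemma first_branch_cycle j k i : (k < m)%N ->
  g (j * m + k + 2) i = t ^+ (m - k.+1) * (i == j.+1)%:R.
Proof.
by move=> km; rewrite /g addn2 /= modnMDl modn_small // divnMDl // divn_small
  // addn0.
Qed.

Lemma first_branch_branch j i : g (branch m j) i = (i == j)%:R.
Proof.
case: j => [//|j]; rewrite /branch.
have -> : (j.+1 * m + (0 < j.+1) = j * m + m.-1 + 2)%N by lia.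
by rewrite first_branch_cycle ?prednK // subnn expr0 mul1r.
Qed.

Lemma branch_lt i : (i <= r)%N -> (branch m i < (r * m).+2)%N.
Proof.
by move=> ir; have : (i * m <= r * m)%N;
  [rewrite leq_mul2r ir orbT | rewrite /branch; lia].
Qed.

Lemma branch_inj : injective (branch m).
Proof.
rewrite /branch => i j; have [/(@block_lt m)|/(@block_lt m)|//] := ltngtP i j;
  lia.
Qed.

Definition branch_ord (i : 'I_r.+1) : 'I_(r * m).+2 := inord (branch m i).

Lemma branch_ordE i : branch_ord i = branch m i :> nat.
Proof. by rewrite inordK ?branch_lt // -ltnS. Qed.

Lemma branch_ord_inj : injective branch_ord.
Proof.
by move=> i j /(congr1 val) /=; rewrite !branch_ordE => /branch_inj/val_inj.
Qed.

Lemma notin_branch_ord (u : 'I_(r * m).+2) i : u \notin codom branch_ord ->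
  (i <= r)%N -> u != branch m i :> nat.
Proof.
move=> uf ir; apply: contraNneq uf => uE; apply/codomP; exists (inord i).
by apply: val_inj; rewrite /= branch_ordE inordK.
Qed.

(** The arcs out of each kind of vertex show that [first_branch] solves the
    system in [det_first_return]; numbers of vertices increase along the arcs
    that end outside the branch vertices, once branch vertices are given
    height 0. *)
Lemma det_branches : t != 0 ->
  \det (1%:M - t *: adj_mx F m r) = cycle_poly (t ^+ m.+2) r.+2.
Proof.
move=> t0; rewrite -det_return_mx //.
have N2 : (r * m + 2 = (r * m).+2)%N by rewrite addn2.
pose Y : 'M[F]_((r * m).+2, r.+1) := \matrix_(u, i) g u i.
have AY u i : ((1%:M - t *: adj_mx F m r) *m Y) u i
    = g u i - t * \sum_(v < (r * m).+2) (adj m r u v)%:R * g v i.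
  rewrite mulmxBl mul1mx -scalemxAl !mxE; congr (_ - _ * _).
  by apply: eq_bigr => v _; rewrite !mxE.
pose h u :=
  if [exists i : 'I_r.+1, u == branch_ord i] then 0%N else nat_of_ord u.
apply: (@det_first_return _ _ _ _ _ branch_ord h Y);
  first exact: branch_ord_inj.
- move=> u v vf; rewrite mxE; case uv: (adj m r u v); rewrite ?eqxx // => _.
  have v0 := notin_branch_ord vf (leq0n r); rewrite /branch /= in v0.
  have vi : [exists i, v == branch_ord i] = false.
    by apply/existsP => -[i /eqP vi]; rewrite vi codom_f in vf.
  rewrite /h vi; case: ifPn => [_|ui]; first by rewrite lt0n.
  move: uv; rewrite adj_interior ?N2 // => [/eqP -> //|i ir].
  apply: notin_branch_ord ir; apply: contra ui => /codomP[j ->].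
  by apply/existsP; exists j.
- apply/matrixP => i j; rewrite mul_select_mx !mxE branch_ordE
    first_branch_branch.
  by rewrite eq_sym.
apply/matrixP => u i; rewrite AY.
have [/codomP[a ->]|uf] := boolP (u \in codom branch_ord); last first.
  rewrite tr_select_mul0 //.
  have ub k : (k <= r)%N -> u != branch m k :> nat by apply: notin_branch_ord.
  under eq_bigr => v _ do rewrite adj_interior ?N2 //.
  rewrite (sum_delta _ _ (fun v => g v i)).
  have ur : (u < r * m + 2)%N by rewrite N2.
  case: (vertexP m0 r0 ur) => [[k kr uk]|u1|[j [k [jr km uE]]]].
  - by have := ub k kr; rewrite uk eqxx.
  - rewrite u1; have -> : (2 < (r * m).+2)%N by nia.
    have := @first_branch_cycle 0 0 i m0; rewrite mul0n => ->.
    by rewrite mul1r /= mulrA -exprS subn1 prednK // subrr.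
  have -> : (u.+1 < (r * m).+2)%N.
    by have := @block_lt m j r jr; lia.
  have -> : u.+1 = (j * m + k.+1 + 2)%N by lia.
  rewrite uE !first_branch_cycle ?(ltnW km) // mul1r mulrA -exprS.
  by rewrite -subSn // subSS subrr.
rewrite tr_select_mul ?branch_ordE; last exact: branch_ord_inj.
rewrite first_branch_branch mxE.
have sum2 (x y : nat) (b : bool) : x <> y -> (x < (r * m).+2)%N ->
    (b -> (y < (r * m).+2)%N) ->
    \sum_(v < (r * m).+2) ((v == x :> nat) || b && (v == y :> nat))%:R * g v i
      = g x i + b%:R * g y i.
  move=> xy xN yN.
  have E v : ((v == x) || b && (v == y))%:R
      = (v == x)%:R + b%:R * (v == y)%:R :> F.
    case: eqP => [->|_]; case: b {yN}; rewrite ?mul1r ?mul0r ?addr0 ?add0r //.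
    by rewrite (introF eqP xy) addr0.
  under eq_bigr => v _ do rewrite E mulrDl -mulrA.
  rewrite big_split /= -mulr_sumr !(sum_delta _ _ (fun v => g v i)) xN mul1r.
  congr (_ + _); case: b yN {E} => [->|] //; rewrite ?mul0r ?mul1r //.
case: a => -[|b] br /=.
  have -> : branch m 0 = 0%N by [].
  under eq_bigr => v _ do rewrite adj_root //.
  rewrite sum2 => [|//|//|r1]; last by nia.
  have -> : (g 1 i = t ^+ m * (i == 1%N :> nat)%:R)%R by [].
  have -> : g m.+2 i = t ^+ m.-1 * (i == 2%N :> nat)%:R.
    by have := @first_branch_cycle 1 0 i m0; rewrite mul1n addn0 addn2 subn1.
  rewrite mulrDr mulrA -exprS [t * (_%:R * _)]mulrCA (mulrA t) -exprS prednK //.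
  have -> : (1 < r)%N%:R * (t ^+ m * (i == 2%N :> nat)%:R)
      = t ^+ m * (i == 2%N :> nat)%:R.
    case: ltnP => r1; rewrite ?mul1r //.
    by rewrite [_ == 2]ltn_eqF ?mulr0 // (leq_trans (ltn_ord i)).
  by rewrite mulr0 subr0 opprD addrA addrAC.
under eq_bigr => v _ do rewrite adj_branch //.
rewrite sum2; first last.
- move=> b2; have : (b.+3 * m <= r * m)%N by rewrite leq_mul2r b2 orbT.
  by lia.
- by apply: branch_lt; apply: ltnW.
- by rewrite /branch /=; case: (b) => [|b']; nia.
rewrite /= first_branch_branch -[(_ * m + 2)%N]/(b.+2 * m + 2)%N.
have -> : (b.+2 * m + 2 = b.+2 * m + 0 + 2)%N by rewrite addn0.
rewrite first_branch_cycle // subn1 mulr0 subr0 eqSS.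
have -> : (b.+2 < r)%N%:R * (t ^+ m.-1 * (i == b.+3 :> nat)%:R)
    = t ^+ m.-1 * (i == b.+3 :> nat)%:R :> F.
  case: ltnP => br2; rewrite ?mul1r //.
  by rewrite [_ == b.+3]ltn_eqF ?mulr0 // (leq_trans (ltn_ord i)).
by rewrite mulrDr mulrA -exprS prednK // opprD addrA.
Qed.

End Branches.

(** * Cutting walks at layer 0 *)

Section LayerClasses.
Variables (F : fieldType) (m r : nat).
Hypotheses (m0 : (0 < m)%N) (r0 : (0 < r)%N).
Local Notation n := m.+2.
Local Notation N := (r * m).+2.
Local Notation A := (adj_mx F m r).

Lemma mem_layer_class c v :
  (v \in layer_class n r c) =
    (0 < v <= r * m + 2)%N && (lay m v.-1 == c %% n)%N.
Proof.
rewrite mem_filter mem_iota andbC.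
have -> : ((0 < v) && (v < 1 + (r * n - 2 * r + 2)) = (0 < v <= r * m + 2))%N.
  by have -> : (r * n - 2 * r = r * m)%N by [lia | nia]; lia.
by have [vr|//] := boolP (0 < v <= _)%N; rewrite layerE.
Qed.

Definition layer_ord c (i : 'I_(size (layer_class n r c))) : 'I_N :=
  inord (nth 0%N (layer_class n r c) i).-1.

Lemma layer_ordE c i : (@layer_ord c i).+1 = nth 0%N (layer_class n r c) i.
Proof.
have := mem_nth 0%N (ltn_ord i);
  rewrite mem_layer_class => /andP[/andP[v0 vN] _].
by rewrite inordK prednK // -(addn2 (r * m)).
Qed.

Lemma layer_ord_inj c : injective (@layer_ord c).
Proof.
move=> i j ij; apply: val_inj; apply/eqP => /=.
rewrite -(nth_uniq 0%N (ltn_ord i) (ltn_ord j)) ?filter_uniq ?iota_uniq //.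
by rewrite -!layer_ordE ij.
Qed.

Lemma codom_layer_ord c u :
  (u \in codom (@layer_ord c)) = (lay m u == c %% n)%N.
Proof.
apply/codomP/idP => [[i ->]|uc].
  have := mem_nth 0%N (ltn_ord i); rewrite mem_layer_class -layer_ordE.
  by case/andP.
have uV : u.+1 \in layer_class n r c.
  by rewrite mem_layer_class uc andbT addn2 ltn_ord.
have iV : (index u.+1 (layer_class n r c) < size (layer_class n r c))%N.
  by rewrite index_mem.
exists (Ordinal iV); apply: val_inj; apply: succn_inj.
by rewrite layer_ordE nth_index.
Qed.

Local Notation S c := (select_mx F (@layer_ord c)).
Local Notation D c := ((S c)^T *m S c).

Lemma layer_projE c u v : D c u v = ((u == v) && (lay m u == c %% n)%N)%:R.
Proof. by rewrite tr_select_mulE ?codom_layer_ord //; apply: layer_ord_inj. Qed.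

Lemma mul_layer_proj q (X : 'M[F]_(q, N)) c u v :
  (X *m D c) u v = X u v * (lay m v == c %% n)%N%:R.
Proof.
rewrite mxE (bigD1 v) //= layer_projE eqxx big1 ?addr0 // => w /negPf wv.
by rewrite layer_projE wv mulr0.
Qed.

Lemma layer_proj_mul q (X : 'M[F]_(N, q)) c u v :
  (D c *m X) u v = (lay m u == c %% n)%N%:R * X u v.
Proof.
rewrite mxE (bigD1 u) //= layer_projE eqxx big1 ?addr0 // => w.
by rewrite eq_sym => /negPf uw; rewrite layer_projE uw mul0r.
Qed.

(** Every arc goes from a layer to the next one. *)
Lemma adj_layer_proj c : A *m D c.+1 = D c *m A.
Proof.
apply/matrixP => u v; rewrite mul_layer_proj layer_proj_mul mxE.
case uv : (adj m r u v); last by rewrite mul0r mulr0.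
have -> : lay m v = ((lay m u).+1 %% n)%N.
  by apply: (lay_adj m0 r0) uv; rewrite addn2.
rewrite mulrC -[c.+1]addn1 -[(lay m u).+1]addn1 eqn_modDr.
by rewrite [(lay m u %% n)%N]modn_small // ltn_mod.
Qed.

Lemma exp_adj_layer_proj k c : A ^+ k *m D (c + k) = D c *m A ^+ k.
Proof.
elim: k => [|k IH]; first by rewrite addn0 expr0 mulmx1 mul1mx.
by rewrite exprSr -mulmxE -(mulmxA (A ^+ k)) addnS adj_layer_proj !mulmxA -IH
  !mulmxA.
Qed.

Lemma layer_mxE c : layer_mx F n r c = S c *m A *m (S c.+1)^T.
Proof.
apply/matrixP => i j; rewrite mul_mx_tr_select mul_select_mx !mxE.
by rewrite /adj !layer_ordE.
Qed.

Lemma layer_prodE k : layer_prod F n r k = S 0 *m A ^+ k *m (S k)^T.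
Proof.
have SS c := select_mx_trK F (@layer_ord_inj c).
elim: k => [|k IH] /=; first by rewrite expr0 mulmx1 SS.
rewrite IH layer_mxE !mulmxA -[_ *m (S k)^T *m S k]mulmxA.
rewrite -[_ *m D k *m A]mulmxA.
by rewrite -adj_layer_proj -!mulmxA SS mulmx1 exprSr -mulmxE !mulmxA.
Qed.

Lemma layer_class_modn : layer_class n r n = layer_class n r 0.
Proof. by rewrite /layer_class modnn mod0n. Qed.

Lemma cyclic_coreE : cyclic_core F n r = S 0 *m A ^+ n *m (S 0)^T.
Proof.
apply/matrixP => i j; rewrite castmxE layer_prodE !mul_mx_tr_select
  !mul_select_mx.
congr (_ _ _); apply: val_inj; apply: succn_inj; rewrite !layer_ordE //=.
by rewrite layer_class_modn.
Qed.

(** The walks from a vertex to layer 0 of length less than n stop at their first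
    visit to layer 0. Their weights form a geometric sum, which 1 - t A
    telescopes to 1 - (t A) ^ n. *)
Lemma det_layers (t : F) :
  \det (1%:M - t *: A) = \det (1%:M - t ^+ n *: cyclic_core F n r).
Proof.
have SS := select_mx_trK F (@layer_ord_inj 0).
pose Y := (\sum_(c < n) (t *: A) ^+ c) *m (S 0)^T.
apply: (@det_first_return _ _ _ _ _ (@layer_ord 0) (fun u => lay m u) Y).
- exact: layer_ord_inj.
- move=> u v; rewrite codom_layer_ord mod0n mxE.
  case uv: (adj m r u v); rewrite ?eqxx // => + _.
  have -> : lay m v = ((lay m u).+1 %% n)%N.
    by apply: (lay_adj m0 r0) uv; rewrite addn2.
  have : (lay m u < n)%N by rewrite ltn_mod.
  by rewrite leq_eqVlt => /orP[/eqP->|un _]; rewrite ?modnn // modn_small.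
- rewrite /Y big_ord_recl /= expr0 mulmxA mulmxDr mulmx1 mulmxDl SS mulmx_sumr
    mulmx_suml.
  rewrite big1 ?addr0 // => c _; rewrite exprZn -scalemxAr -scalemxAl.
  have -> : S 0 *m A ^+ bump 0 c *m (S 0)^T = 0; last by rewrite scaler0.
  have cn : (bump 0 c < n)%N by rewrite /bump /= add1n ltnS.
  have D0 : (S 0)^T = D 0 *m (S 0)^T by rewrite -mulmxA SS mulmx1.
  have DD : D (0 + bump 0 c) *m D 0 = 0.
    apply/matrixP => u v; rewrite mul_layer_proj layer_projE mxE add0n mod0n.
    rewrite modn_small //; case: eqP => [->|_]; last by rewrite mul0r.
    by case: (lay m v) => [|w]; rewrite /bump /= ?mul0r ?mulr0.
  have S0 : S 0 = S 0 *m D 0 by rewrite mulmxA SS mul1mx.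
  rewrite {1}D0 {1}S0 -(mulmxA (S 0)) -exp_adj_layer_proj.
  have -> : forall X : 'M[F]_N, S 0 *m (X *m D (0 + bump 0 c)) *m (D 0 *m (S
    0)^T)
      = S 0 *m X *m (D (0 + bump 0 c) *m D 0) *m (S 0)^T.
    by move=> X; rewrite !mulmxA.
  by rewrite DD mulmx0 mul0mx.
have geom :
    (1%:M - t *: A) *m (\sum_(c < n) (t *: A) ^+ c) = 1%:M - (t *: A) ^+ n.
  have /esym := subrX1 (t *: A) n => /(congr1 -%R); rewrite -mulNr !opprB.
  exact.
rewrite /Y mulmxA geom cyclic_coreE mulmxBl mulmxBr mul1mx mulmx1 exprZn.
rewrite -!scalemxAl -!scalemxAr; congr (_ - _ *: _).
have DA : D 0 *m A ^+ n = A ^+ n *m D 0.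
  rewrite -exp_adj_layer_proj; congr (_ *m _).
  by apply/matrixP => u v; rewrite !layer_projE modnn mod0n.
move: (A ^+ n) DA => B DB.
by rewrite !mulmxA DB -!mulmxA SS mulmx1.
Qed.

End LayerClasses.

(** At y <> 0 both determinants of 1 - t A are compared for a t such that
    t ^ n = 1 / y. The powers of the variable account for the different
    multiplicities of the root 0. *)
Lemma char_poly_cyclic_core (C : numClosedFieldType) m r :
  (0 < m)%N -> (0 < r)%N ->
  'X^(r.+2) * char_poly (cyclic_core C m.+2 r)
    = 'X^(size (layer_class m.+2 r 0)) * reciprocal C r.+2.
Proof.
move=> m0 r0; apply: poly_eq_nonzero => y y0; set K := cyclic_core _ _ _.
have charE : (char_poly K).[y]
    = y ^+ size (layer_class m.+2 r 0) * \det (1%:M - y^-1 *: K).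
  rewrite -detZ /char_poly -horner_evalE -det_map_mx; congr (\det _).
  apply/matrixP=> i j; rewrite !mxE /= /horner_eval hornerD hornerN.
  rewrite hornerMn hornerX hornerC mulrBr mulrA divff // mul1r.
  by case: eqP; rewrite ?mulr1 ?mulr0.
pose t := m.+2.-root y^-1.
have tn : t ^+ m.+2 = y^-1 by rewrite rootCK.
have t0 : t != 0.
  by apply: contraTneq (invr_neq0 y0) => tz; rewrite -tn tz expr0n eqxx.
rewrite [LHS]hornerM [RHS]hornerM !hornerXn charE -tn -det_layers //
  det_branches // tn.
rewrite horner_reciprocal //; exact: mulrCA.
Qed.

Theorem theorem3p4 (R : realType) (n r : nat) (hn : (3 <= n)%N)
    (hr : (1 <= r)%N) (x : R[i])
    (hx : eigenvalue (cyclic_core R[i] n r) x) (hx0 : x != 0) :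
  [/\ x \is Num.real, 0 < x & mup x (char_poly (cyclic_core R[i] n r)) = 1%N].
Proof.
case: n hn hx => [|[|m]] // m0; rewrite eigenvalue_root_char.
set p := char_poly _ => px.
have pE : 'X^(r.+2) * p
    = 'X^(size (layer_class m.+2 r 0)) * reciprocal R[i] r.+2.
  exact: char_poly_cyclic_core.
have Xn_x k : ~~ root 'X^k x by rewrite /root hornerXn expf_neq0.
have root_p : root (reciprocal R[i] r.+2) x.
  have : root ('X^(r.+2) * p) x by rewrite rootM px orbT.
  by rewrite pE rootM (negPf (Xn_x _)).
have [x_gt0 mupx] := reciprocal_nonzero_root hx0 root_p.
split=> //; first by rewrite realE (ltW x_gt0).
by rewrite -(mupMr p (Xn_x r.+2)) pE mupMr.
Qed.
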